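(* Every consistent path system $\mathcal{P}$ on $n$ vertices satisfies $\Delta(\mathcal{P}) \le 2\sqrt{n}$.
   Context: Let $G=(V,E)$ be a finite connected (undirected, simple) graph. A consistent path system $\mathcal{P}$ in $G$ (on the vertex set $V$) is a collection of simple paths in $G$ such that: (1) for every $u,v\in V$ there is a unique path $P_{u,v}\in\mathcal{P}$ connecting $u$ and $v$, with $P_{u,v}=P_{v,u}$ as undirected paths ($P_{u,u}$ being the trivial one-vertex path); (2) if $P\in\mathcal{P}$ and $x,y$ are vertices of $P$, then the $(xy)$-subpath of $P$ is $P_{x,y}\in\mathcal{P}$. ''On $n$ vertices'' means $|V|=n$. For a metric $\rho$ on $V$ and a path $P=(x_0,x_1,\dots,x_k)$ put $\rho(P)=\sum_{i=1}^k\rho(x_{i-1},x_i)$. For real $\alpha\ge 1$, $\mathcal{P}$ is called $\alpha$-metric if there is a metric $\rho$ on $V$ with $\rho(u,v)\le\rho(P_{u,v})\le\alpha\,\rho(u,v)$ for all $P_{u,v}\in\mathcal{P}$. Define $\Delta(\mathcal{P})=\inf\{\alpha\ge 1:\mathcal{P}\text{ is }\alpha\text{-metric}\}$. *)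

(* Defs.v *)
From mathcomp Require Import all_boot all_order all_algebra.
From mathcomp Require Import all_classical all_reals all_analysis.

Set Implicit Arguments.
Unset Strict Implicit.
Unset Printing Implicit Defensive.

Import Order.TTheory GRing.Theory Num.Theory.

Local Open Scope classical_set_scope.
Local Open Scope ring_scope.

Definition simple_graph (V : finType) (e : rel V) : Prop :=
  symmetric e /\ irreflexive e.

Definition connected_graph (V : finType) (e : rel V) : Prop :=
  (0 < #|V|)%N /\ forall u v : V, connect e u v.

(* A path is the sequence of all its vertices, both endpoints included; an
   undirected path is therefore a sequence up to reversal. *)
Definition simple_path (V : finType) (e : rel V) (u v : V) (s : seq V) : Prop :=
  exists p : seq V, [/\ s = u :: p, path e u p, last u p = v & uniq s].

(* [P u v] is the path P_{u,v}, traversed from [u] to [v]. In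
   [cps_subpath], [s] is the part of [P u v] between the vertices [x] and [y]
   when [x] comes before [y]; in the other case [s] is an infix of
   [P v u = rev (P u v)]. *)
Record consistent_path_system (V : finType) (e : rel V)
    (P : V -> V -> seq V) : Prop := ConsistentPathSystem {
  cps_path : forall u v, simple_path e u v (P u v);
  cps_sym : forall u v, P v u = rev (P u v);
  cps_subpath : forall u v x y s,
    simple_path e x y s -> infix s (P u v) -> P x y = s
}.

Record is_metric (R : realType) (V : finType) (rho : V -> V -> R) : Prop :=
  IsMetric {
  is_metric_ge0 : forall x y, 0 <= rho x y;
  is_metric_eq0 : forall x y, rho x y = 0 <-> x = y;
  is_metric_sym : forall x y, rho x y = rho y x;
  is_metric_triangle : forall x y z, rho x z <= rho x y + rho y z
}.

Definition path_length (R : realType) (V : finType) (rho : V -> V -> R)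
    (s : seq V) : R :=
  \sum_(xy <- zip s (behead s)) rho xy.1 xy.2.

Definition alpha_metric (R : realType) (V : finType) (P : V -> V -> seq V)
    (alpha : R) : Prop :=
  exists rho : V -> V -> R, is_metric rho /\
    forall u v, rho u v <= path_length rho (P u v) <= alpha * rho u v.

(* The infimum is taken in the extended reals, where the infimum of the empty
   set is +oo (the real-valued [inf] would return 0). *)
Definition Delta (R : realType) (V : finType) (P : V -> V -> seq V) : \bar R :=
  ereal_inf [set alpha%:E | alpha in
               [set alpha : R | 1 <= alpha /\ alpha_metric P alpha]].
Arguments Delta R {V} P.

(* Main.v *)
Require Import Defs.
From mathcomp Require Import all_boot all_order all_algebra.
From mathcomp Require Import all_classical all_reals all_analysis.
From mathcomp Require Import zify lra.

(** The distortion is achieved by a metric with two scales, built from a few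
    long paths of the system.

    Consistency makes any two paths of the system meet in a common subpath
    ([contiguous_cps]). Fix a list [Ls] of paths of the system, and call the set
    of those members of [Ls] that contain a vertex the bundle of that vertex.
    Two distinct vertices are linked when all vertices of the path of the system
    between them have the same nonempty bundle; every vertex is linked to itself.
    Distinct linked vertices lie on a common member of [Ls], so linkedness is an
    equivalence relation, and on each of its classes the hop distance along the
    system is the distance of a line. Put
    [rho x y = eps * hops] for linked vertices and [rho x y = 1] for all
    others: this is a metric as soon as [eps * n <= 1]
    ([atom_metric_is_metric]). Paths between linked vertices are geodesics, and
    any other path [P u v] has [rho u v = 1] and length at most [eps * n] plus
    the number of its edges whose ends are not linked. Letting [eps] tend to 0,
    it suffices to find [Ls] such that every path of the system has at most
    [2 * sqrt n] such edges, called breaks.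

    The list is found greedily: as long as some path of the system has more than
    [2 * sqrt n] breaks, add it to the list. A break starts at an uncovered
    vertex or enters or leaves a member of [Ls]; since each member is met in a
    subpath, it accounts for at most two breaks of the second kind
    ([breaks_le]). So the path added to a list of [j] paths covers more than
    [2 * sqrt n - 2 * j] new vertices, and [j] steps cover at least
    [2 * sqrt n * j - j * (j - 1)] vertices ([greedy_cover]). For
    [sqrt n < j <= sqrt n + 1] this exceeds [n], so the procedure stops before
    ([few_breaks]). *)

Set Implicit Arguments.
Unset Strict Implicit.
Unset Printing Implicit Defensive.

Import Order.TTheory GRing.Theory Num.Theory.

Local Open Scope ring_scope.

(** * Switches of a predicate along a sequence *)

Definition links (T : Type) (s : seq T) : seq (T * T) := zip s (behead s).

Lemma links_cons (T : Type) (x y : T) (s : seq T) :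
  links (x :: y :: s) = (x, y) :: links (y :: s).
Proof. by []. Qed.

Lemma size_links (T : Type) (s : seq T) : size (links s) = (size s).-1.
Proof. by rewrite /links size_zip size_behead; apply/minn_idPr/leq_pred. Qed.

Lemma infix_links (T : eqType) (x y : T) (s : seq T) :
  (x, y) \in links s -> infix [:: x; y] s.
Proof.
elim: s => [|a [|b s] IHs] //; rewrite links_cons inE => /orP[/eqP[-> ->]|].
  by apply/infixP; exists [::], s.
by move=> /IHs; apply: (@infix_catl _ _ _ [:: a]).
Qed.

Lemma count_links_fst (T : Type) (a : pred T) (s : seq T) :
  (count (fun xy => a xy.1) (links s) <= count a s)%N.
Proof.
elim: s => [|x [|y s] IHs] //.
rewrite links_cons [X in (X <= _)%N]/= [X in (_ <= X)%N]/=.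
by rewrite leq_add2l.
Qed.

Lemma count_has_le (T U : Type) (r : T -> U -> bool) (us : seq U) (s : seq T) :
  (count (fun x => has (r x) us) s <= \sum_(w <- us) count (r^~ w) s)%N.
Proof.
elim: us => [|w us IHus]; first by rewrite big_nil count_pred0.
rewrite big_cons; apply: leq_trans (leq_add (leqnn _) IHus).
by rewrite -count_predUI leq_addr.
Qed.

Definition switches (T : Type) (a : pred T) (s : seq T) : nat :=
  count (fun xy => a xy.1 != a xy.2) (links s).

(** Taking a default [x0] for each use avoids assuming that [T] is inhabited. *)
Definition contiguous (T : Type) (a : pred T) (s : seq T) : Prop :=
  forall x0 i j k, (i <= j)%N -> (j <= k)%N -> (k < size s)%N ->
    a (nth x0 s i) -> a (nth x0 s k) -> a (nth x0 s j).

Lemma contiguous_behead (T : Type) (a : pred T) (x : T) (s : seq T) :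
  contiguous a (x :: s) -> contiguous a s.
Proof. by move=> cs x0 i j k ij jk ks; apply: (cs x0 i.+1 j.+1 k.+1). Qed.

Lemma switches_hasN (T : eqType) (a : pred T) (s : seq T) :
  ~~ has a s -> switches a s = 0%N.
Proof.
elim: s => [|x [|y s] IHs] // nas; rewrite /switches links_cons /=.
rewrite -/(switches a (y :: s)) IHs; last by apply: contra nas => /= ->; rewrite orbT.
by move: nas; rewrite /= !negb_or => /and3P[/negbTE-> /negbTE->].
Qed.

(** From a start inside the contiguous region, the only possible switch is the
    exit: a second one would re-enter the region. *)
Lemma switches_head (T : eqType) (a : pred T) (x : T) (s : seq T) :
  contiguous a (x :: s) -> a x -> (switches a (x :: s) <= 1)%N.
Proof.
elim: s x => [|y s IHs] x // cs ax; rewrite /switches links_cons /= ax.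
rewrite -/(switches a (y :: s)); case ay: (a y).
  exact: IHs (contiguous_behead cs) ay.
rewrite switches_hasN //=; apply/negP; rewrite ay => /(has_nthP x)[k ks ak].
by have := cs x 0%N 1%N k.+2 isT isT ks ax ak; rewrite /= ay.
Qed.

(** One switch to enter the contiguous region and one to leave it. *)
Lemma switches_contiguous (T : eqType) (a : pred T) (s : seq T) :
  contiguous a s -> (switches a s <= 2)%N.
Proof.
elim: s => [|x [|y s] IHs] // cs; case ax: (a x).
  exact: leq_trans (switches_head cs ax) _.
rewrite /switches links_cons /= ax -/(switches a (y :: s)).
have cs' := contiguous_behead cs; case ay: (a y); last exact: IHs.
by rewrite ltnS switches_head.
Qed.

(** * Geometry of a consistent path system *)

Section ConsistentPathSystem.

Variables (V : finType) (e : rel V) (P : V -> V -> seq V).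
Hypothesis cpsP : consistent_path_system e P.

Lemma cps_uniq u v : uniq (P u v).
Proof. by have [p [_ _ _]] := cps_path cpsP u v. Qed.

Lemma cps_sorted u v : sorted e (P u v).
Proof. by have [p [-> ? _ _]] := cps_path cpsP u v. Qed.

Lemma cps_snd u v : v \in P u v.
Proof. by have [p [-> _ <- _]] := cps_path cpsP u v; rewrite mem_last. Qed.

Lemma mem_cpsC u v z : (z \in P v u) = (z \in P u v).
Proof. by rewrite (cps_sym cpsP) mem_rev. Qed.

Lemma size_cpsC u v : size (P v u) = size (P u v).
Proof. by rewrite (cps_sym cpsP) size_rev. Qed.

Lemma cps_refl u : P u u = [:: u].
Proof.
have [[|x p] [-> _ // lp]] := cps_path cpsP u u.
by rewrite /= -[X in X \in _]lp /= mem_last.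
Qed.

Lemma size_cps_le u v : (size (P u v) <= #|V|)%N.
Proof. by rewrite -(card_uniqP (cps_uniq u v)) max_card. Qed.

Lemma size_cps_gt1 u v : u != v -> (1 < size (P u v))%N.
Proof.
have [[|x p] [-> _ /= <- _]] := cps_path cpsP u v; last by [].
by rewrite eqxx.
Qed.

Lemma cps_infix u v x y s : infix (x :: s) (P u v) -> last x s = y ->
  P x y = x :: s.
Proof.
move=> inf lst; apply: (cps_subpath cpsP _ inf); exists s; split=> //.
- exact: (infix_sorted inf (cps_sorted u v)).
- exact: infix_uniq inf (cps_uniq u v).
Qed.

Lemma cps_link u v x y : (x, y) \in links (P u v) -> P x y = [:: x; y].
Proof. by move/infix_links/cps_infix; apply. Qed.

(** The stretch of [P u v] from [x] to [y] is an infix, hence it is the path that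
    the system assigns to its ends. This turns every question about vertices of
    one path of the system into arithmetic on their indices. *)
Lemma cps_segment u v x y (L := P u v) :
  x \in L -> y \in L -> (index x L <= index y L)%N ->
  P x y = drop (index x L) (take (index y L).+1 L).
Proof.
move=> xL yL; set i := index x L; set j := index y L => ij.
have jL : (j < size L)%N by rewrite index_mem.
have inf : infix (drop i (take j.+1 L)) L.
  by apply: infix_trans (infix_drop _ _) _; apply: infix_take.
have E : drop i (take j.+1 L) = x :: drop i.+1 (take j.+1 L).
  by rewrite (drop_nth x) ?nth_take ?nth_index // size_takel.
rewrite E; rewrite E in inf; apply: (cps_infix inf).
rewrite -[LHS]/(last x (x :: _)) -E (take_nth y) // nth_index //.
by rewrite drop_rcons ?last_rcons // size_takel // ltnW.
Qed.

Lemma size_cps_segment u v x y (L := P u v) :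
  x \in L -> y \in L -> (index x L <= index y L)%N ->
  size (P x y) = (index y L - index x L).+1.
Proof.
move=> xL yL ij; rewrite (cps_segment xL yL ij) size_drop size_takel ?subSn //.
by rewrite index_mem.
Qed.

Lemma mem_cps_segment u v x y z (L := P u v) :
  x \in L -> y \in L -> (index x L <= index y L)%N ->
  (z \in P x y) = (z \in L) && (index x L <= index z L <= index y L)%N.
Proof.
move=> xL yL ij; rewrite (cps_segment xL yL ij).
set i := index x L; set j := index y L; set t := take j.+1 L.
have zt : (z \in t) = (z \in L) && (index z L <= j)%N.
  case zL: (z \in L); first by rewrite in_take.
  by apply: contraFF zL => /mem_take.
have ut : uniq t by rewrite take_uniq ?cps_uniq.
have [zT|zT] := boolP (z \in t); last first.
  rewrite andbA andbAC -zt (negbTE zT) /=.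
  by apply: contraNF zT => /mem_drop.
have idx : index z L = index z t.
  by rewrite -{1}(cat_take_drop j.+1 L) index_cat -/t zT.
have := zT; rewrite zt idx => /andP[-> zj].
rewrite zj andbT /=.
have := in_take i zT; move: ut zT; rewrite -{1 2}(cat_take_drop i t) cat_uniq mem_cat.
move=> /and3P[_ /hasPn disj _] zT zi.
rewrite leqNgt -zi; case: (boolP (z \in drop i t)) zT => [/disj-> //|_].
by rewrite orbF => ->.
Qed.

Lemma cps_convex u v x y z :
  x \in P u v -> y \in P u v -> z \in P x y -> z \in P u v.
Proof.
move=> xL yL; case: (leqP (index x (P u v)) (index y (P u v))) => [|/ltnW] ij.
  by rewrite (mem_cps_segment z xL yL ij) => /andP[].
by rewrite mem_cpsC (mem_cps_segment z yL xL ij) => /andP[].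
Qed.

(** On a line, the segment from [x] to [z] is covered by any detour through [y]. *)
Lemma cps_sub_cat u v x y z t :
  x \in P u v -> y \in P u v -> z \in P u v ->
  t \in P x z -> (t \in P x y) || (t \in P y z).
Proof.
have W a b : a \in P u v -> b \in P u v -> (t \in P a b) =
   (t \in P u v) && ((index a (P u v) <= index t (P u v) <= index b (P u v)) ||
    (index b (P u v) <= index t (P u v) <= index a (P u v)))%N.
  move=> aL bL; case: (leqP (index a (P u v)) (index b (P u v))) => [|/ltnW] ij.
    rewrite (mem_cps_segment t aL bL ij); case: (t \in P u v) => //=.
    by move: (index a _) (index b _) (index t _) ij => i j l {aL bL}; lia.
  rewrite mem_cpsC (mem_cps_segment t bL aL ij); case: (t \in P u v) => //=.
  by move: (index a _) (index b _) (index t _) ij => i j l {aL bL}; lia.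
move=> xL yL zL; rewrite (W x z) // (W x y) // (W y z) //; case: (t \in P u v) => //=.
move: (index x _) (index y _) (index z _) (index t _) => i j k l {W xL yL zL}.
by case: (leqP i l); case: (leqP l j); case: (leqP j l) => /=; lia.
Qed.

Lemma size_cps_triangle u v x y z :
  x \in P u v -> y \in P u v -> z \in P u v ->
  ((size (P x z)).-1 <= (size (P x y)).-1 + (size (P y z)).-1)%N.
Proof.
have W a b : a \in P u v -> b \in P u v -> (size (P a b)).-1 =
   ((index a (P u v) - index b (P u v)) +
    (index b (P u v) - index a (P u v)))%N.
  move=> aL bL; case: (leqP (index a (P u v)) (index b (P u v))) => [|/ltnW] ij.
    by rewrite (size_cps_segment aL bL ij) (eqP ij) addnC addn0.
  by rewrite size_cpsC (size_cps_segment bL aL ij) (eqP ij) addn0.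
move=> xL yL zL; rewrite !W //.
move: (index x _) (index y _) (index z _) => i j k {W xL yL zL}; lia.
Qed.

(** Two paths of the system meet in a subpath of both: the path between two
    common vertices lies in each of them. *)
Lemma contiguous_cps u v a b : contiguous (fun x => x \in P a b) (P u v).
Proof.
move=> x0 i j k ij jk ks iL kL.
have js := leq_ltn_trans jk ks; have is_ := leq_ltn_trans ij js.
apply: (cps_convex iL kL).
rewrite (@mem_cps_segment u v) ?mem_nth ?index_uniq ?cps_uniq //.
  by rewrite ij jk.
exact: leq_trans ij jk.
Qed.

(** * Bundles and breaks *)

Definition from_system (Ls : seq (seq V)) : Prop :=
  forall L, L \in Ls -> exists a b, L = P a b.

Definition bundle (Ls : seq (seq V)) (x : V) : seq (seq V) :=
  [seq L <- Ls | x \in L].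

Definition covered (Ls : seq (seq V)) : {set V} :=
  [set x | bundle Ls x != [::]].

(** Every edge of [s] whose ends are not linked (see below) is counted here,
    whenever [s] is a path of the system. *)
Definition breaks (Ls : seq (seq V)) (s : seq V) : nat :=
  count (fun xy => (xy.1 \notin covered Ls) ||
                   (bundle Ls xy.1 != bundle Ls xy.2)) (links s).

Lemma covered_cons L Ls : covered (L :: Ls) = [set x in L] :|: covered Ls.
Proof. by apply/setP=> x; rewrite !inE /=; case: ifP. Qed.

Lemma bundle_neq_switch Ls x y : bundle Ls x != bundle Ls y ->
  has (fun L => (x \in L) != (y \in L)) Ls.
Proof.
apply: contraR => /hasPn same; apply/eqP/eq_in_filter => L LLs.
by apply/eqP; rewrite -[_ == _]negbK same.
Qed.

(** A break with a covered start enters or leaves a member of [Ls], and each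
    member is entered at most once and left at most once. *)
Lemma breaks_le Ls u v : from_system Ls ->
  (breaks Ls (P u v) <= count (predC (mem (covered Ls))) (P u v) +
                        2 * size Ls)%N.
Proof.
move=> sysLs.
pose sw (xy : V * V) (L : seq V) := (xy.1 \in L) != (xy.2 \in L).
have -> : (2 * size Ls = \sum_(L <- Ls) 2)%N
  by rewrite big_const_seq count_predT iter_addn_0.
apply: leq_trans (leq_add (count_links_fst _ _) (leqnn _)).
have sw2 : (\sum_(L <- Ls) count (sw^~ L) (links (P u v)) <= \sum_(L <- Ls) 2)%N.
  rewrite !big_seq; apply: leq_sum => L /sysLs[a [b ->]].
  exact: switches_contiguous (@contiguous_cps u v a b).
apply: leq_trans (leq_add (leqnn _) (leq_trans (count_has_le _ _ _) sw2)).
rewrite -count_predUI; apply: leq_trans (leq_addr _ _).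
apply: sub_count => -[x y] /= /orP[-> //|/bundle_neq_switch h].
by rewrite [X in _ || X]h orbT.
Qed.

Lemma card_covered_cons Ls u v :
  #|covered (P u v :: Ls)| =
  (count (predC (mem (covered Ls))) (P u v) + #|covered Ls|)%N.
Proof.
have -> : covered (P u v :: Ls) = ([set x in P u v] :\: covered Ls) :|: covered Ls.
  by apply/setP=> x; rewrite covered_cons !inE; case: (_ \in P u v); case: (bundle _ _ == _).
have disj : ([set x in P u v] :\: covered Ls) :&: covered Ls = finset.set0.
  by apply/setP=> x; rewrite !inE; case: (bundle _ _ == _); rewrite ?andbF.
rewrite cardsU disj cards0 subn0 -size_filter; congr (_ + _)%N.
rewrite -(card_uniqP (filter_uniq _ (cps_uniq u v))); apply: eq_card => x.
by rewrite mem_filter !inE.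
Qed.

(** * The greedy list of paths and the two-scale metric *)

Section Metric.

Variable R : realType.

(** The bound is the sum of [t - 2 * i] for [i < j]: a path with more than [t]
    breaks relative to [i] earlier paths has more than [t - 2 * i] vertices not
    covered by them. *)
Lemma greedy_cover (t : R) (j : nat) :
  (exists2 Ls, from_system Ls & forall u v, (breaks Ls (P u v))%:R <= t) \/
  (exists Ls, [/\ from_system Ls, size Ls = j &
     t * j%:R - j%:R * (j%:R - 1) <= #|covered Ls|%:R]).
Proof.
elim: j => [|j [|[Ls [sysLs szLs covLs]]]]; [|by left|].
  by right; exists [::]; split=> //; rewrite mulr0 mul0r subr0.
have [few|] := pselect (forall u v, (breaks Ls (P u v))%:R <= t).
  by left; exists Ls.
move=> /existsNP[u /existsNP[v /negP]]; rewrite -ltNge => many.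
right; exists (P u v :: Ls); split; rewrite /= ?szLs //.
  by move=> L; rewrite inE => /orP[/eqP->|/sysLs//]; exists u, v.
rewrite card_covered_cons natrD -natr1.
have := breaks_le u v sysLs; rewrite szLs -(ler_nat R) natrD natrM => brk.
lra.
Qed.

(** Requiring the whole path, and not only its ends, to lie in one bundle is what
    makes the edges of paths between linked vertices linked in turn. Uncovered
    vertices are linked to themselves only. *)
Definition linked (Ls : seq (seq V)) (x y : V) : bool :=
  (x == y) || ((x \in covered Ls) &&
               all (fun z => bundle Ls z == bundle Ls x) (P x y)).

(** The classes of linked vertices are short lines, at mutual distance 1. *)
Definition atom_metric (Ls : seq (seq V)) (eps : R) (x y : V) : R :=
  if linked Ls x y then eps * (size (P x y)).-1%:R else 1.

Lemma linkedP Ls x y : x != y -> linked Ls x y ->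
  [/\ x \in covered Ls, bundle Ls y = bundle Ls x &
    forall z, z \in P x y -> bundle Ls z = bundle Ls x].
Proof.
rewrite /linked => /negbTE-> /andP[cx /allP bxy]; split=> // [|z /bxy/eqP//].
by apply/eqP/bxy; exact: cps_snd.
Qed.

Lemma linkedC Ls x y : linked Ls x y = linked Ls y x.
Proof.
have W a b : linked Ls a b -> linked Ls b a.
  have [->//|ab] := eqVneq a b; move=> /(linkedP ab)[ca bab lab].
  rewrite /linked; apply/orP; right; apply/andP; split.
    by move: ca; rewrite !inE bab.
  by apply/allP => z; rewrite mem_cpsC bab => /lab ->.
by apply/idP/idP; apply: W.
Qed.

(** The three bundles agree and are nonempty, so any common member of them
    provides the path. *)
Lemma linked_common Ls x y z : from_system Ls -> x != y -> y != z ->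
  linked Ls x y -> linked Ls y z ->
  exists a b, [/\ x \in P a b, y \in P a b & z \in P a b].
Proof.
move=> sysLs xy yz /(linkedP xy)[cx byx _] /(linkedP yz)[_ bzy _].
have : exists L, L \in bundle Ls x.
  by move: cx; rewrite inE; case: (bundle _ _) => // L Ls' _; exists L; rewrite mem_head.
case=> L Lx; have Ly : L \in bundle Ls y by rewrite byx.
have Lz : L \in bundle Ls z by rewrite bzy.
move: Lx Ly Lz; rewrite !mem_filter => /andP[xL LLs] /andP[yL _] /andP[zL _].
by have [a [b E]] := sysLs L LLs; exists a, b; rewrite -E.
Qed.

Lemma linked_trans Ls x y z : from_system Ls ->
  linked Ls x y -> linked Ls y z -> linked Ls x z.
Proof.
move=> sysLs; have [->//|xy] := eqVneq x y; have [->//|yz] := eqVneq y z.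
move=> lxy lyz; have [a [b [xL yL zL]]] := linked_common sysLs xy yz lxy lyz.
have [cx byx bxy] := linkedP xy lxy; have [_ _ byz] := linkedP yz lyz.
rewrite /linked cx; apply/orP; right; apply/allP => t /(cps_sub_cat xL yL zL).
by case/orP => [/bxy->//|/byz->]; rewrite byx.
Qed.

Section AtomMetric.

Variables (Ls : seq (seq V)) (eps : R).
Hypotheses (sysLs : from_system Ls) (eps_gt0 : 0 < eps)
  (eps_le : eps * #|V|%:R <= 1).

Local Notation rho := (atom_metric Ls eps).

Lemma eps_size_le1 x y : eps * (size (P x y)).-1%:R <= 1.
Proof.
apply: le_trans eps_le; rewrite ler_pM2l // ler_nat.
exact: leq_trans (leq_pred _) (size_cps_le _ _).
Qed.

Lemma atom_metric_ge0 x y : 0 <= rho x y.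
Proof. by rewrite /atom_metric; case: ifP => // _; rewrite mulr_ge0 // ltW. Qed.

Lemma atom_metric_le1 x y : rho x y <= 1.
Proof. by rewrite /atom_metric; case: ifP => // _; exact: eps_size_le1. Qed.

Lemma atom_metricxx x : rho x x = 0.
Proof. by rewrite /atom_metric /linked eqxx cps_refl /= mulr0. Qed.

(** Distances never exceed 1, so the triangle inequality only needs an argument
    when both sides of the detour are linked; then the three vertices lie on one
    path of the system, where hop counts are distances on a line. *)
Lemma atom_metric_is_metric : is_metric rho.
Proof.
split.
- exact: atom_metric_ge0.
- move=> x y; split=> [|->]; last exact: atom_metricxx.
  rewrite /atom_metric; case: ifP => _; last by move/eqP; rewrite oner_eq0.
  move/eqP; rewrite mulf_eq0 (gt_eqF eps_gt0) pnatr_eq0 /= => s0.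
  apply/eqP; apply: contraTT isT => /size_cps_gt1; rewrite -ltnS.
  by move: s0; case: (size _) => [|[]].
- by move=> x y; rewrite /atom_metric linkedC size_cpsC.
- move=> x y z.
  have [->|xy] := eqVneq x y; first by rewrite atom_metricxx add0r.
  have [->|yz] := eqVneq y z; first by rewrite atom_metricxx addr0.
  have [lxy|nxy] := boolP (linked Ls x y); last first.
    rewrite {2}/atom_metric (negbTE nxy).
    by rewrite ler_wpDr ?atom_metric_ge0 ?atom_metric_le1.
  have [lyz|nyz] := boolP (linked Ls y z); last first.
    rewrite {3}/atom_metric (negbTE nyz).
    by rewrite ler_wpDl ?atom_metric_ge0 ?atom_metric_le1.
  have [a [b [xL yL zL]]] := linked_common sysLs xy yz lxy lyz.
  rewrite /atom_metric lxy lyz (linked_trans sysLs lxy lyz) -mulrDr -natrD.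
  by rewrite ler_pM2l // ler_nat (size_cps_triangle xL yL zL).
Qed.

Lemma atom_metric_link u v x y : (x, y) \in links (P u v) ->
  rho x y <= eps + ((x \notin covered Ls) || (bundle Ls x != bundle Ls y))%:R.
Proof.
move=> /cps_link Pxy; rewrite /atom_metric /linked Pxy /= eqxx andbT.
rewrite mulr1 [bundle Ls y == _]eq_sym.
have := eps_gt0; case: (x == y); case: (x \in _); case: (_ == _) => /=; lra.
Qed.

Lemma path_length_atom_metric u v :
  path_length rho (P u v) <= eps * (size (P u v)).-1%:R + (breaks Ls (P u v))%:R.
Proof.
rewrite /path_length -/(links _) -size_links.
apply: (@le_trans _ _ (\sum_(xy <- links (P u v)) (eps +
    ((xy.1 \notin covered Ls) || (bundle Ls xy.1 != bundle Ls xy.2))%:R))).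
  by rewrite !big_seq; apply: ler_sum => -[x y]; exact: atom_metric_link.
rewrite big_split /= big_const_seq count_predT iter_addr_0 mulr_natr.
rewrite lerD2l /breaks -sum1_count natr_sum [leRHS]big_mkcond /=.
by apply: ler_sum => xy _; case: ifP.
Qed.

(** All edges of a path between linked vertices are linked, and each contributes
    one hop. *)
Lemma path_length_linked u v : linked Ls u v ->
  path_length rho (P u v) = rho u v.
Proof.
have [->|uv] := eqVneq u v.
  by rewrite atom_metricxx cps_refl /path_length big_nil.
move=> luv; rewrite {2}/atom_metric luv -size_links.
have [cu _ bz] := linkedP uv luv.
rewrite /path_length -/(links _).
transitivity (\sum_(xy <- links (P u v)) eps); last first.
  by rewrite big_const_seq count_predT iter_addr_0 mulr_natr.
rewrite !big_seq; apply: eq_bigr => -[x y] xyP /=.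
have xy_sub z : z \in [:: x; y] -> z \in P u v.
  by case/infixP: (infix_links xyP) => s1 [s2 ->]; rewrite !mem_cat => ->; rewrite orbT.
have bx := bz x (xy_sub x (mem_head _ _)).
have by_ : bundle Ls y = bundle Ls u by apply/bz/xy_sub; rewrite !inE eqxx orbT.
rewrite /atom_metric /linked (cps_link xyP) /= by_ bx !eqxx.
by move: cu; rewrite !inE bx => ->; rewrite orbT mulr1.
Qed.

Lemma path_length_ge u v : rho u v <= path_length rho (P u v).
Proof.
have [p [-> _ <- _]] := cps_path cpsP u v.
have triangle := is_metric_triangle atom_metric_is_metric.
rewrite /path_length -/(links _); elim: p {v} u => [|x p IHp] u /=.
  by rewrite atom_metricxx big_nil.
rewrite links_cons big_cons /=.
by apply: le_trans (triangle _ x _) _; rewrite lerD2l IHp.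
Qed.

End AtomMetric.

(** Unlinked vertices are at distance 1, so their path may be as long as the
    number of its breaks, plus the small contribution of its linked edges. *)
Lemma alpha_metric_of_breaks Ls (eps b : R) : from_system Ls ->
  0 < eps -> eps * #|V|%:R <= 1 -> 1 <= b ->
  (forall u v, (breaks Ls (P u v))%:R <= b) ->
  alpha_metric P (b + eps * #|V|%:R).
Proof.
move=> sysLs e0 e1 b1 brk; exists (atom_metric Ls eps).
split=> [|u v]; first exact: atom_metric_is_metric.
rewrite path_length_ge //=.
have eV0 : 0 <= eps * #|V|%:R by rewrite mulr_ge0 // ltW.
have [luv|nluv] := boolP (linked Ls u v).
  rewrite path_length_linked // ler_peMl ?atom_metric_ge0 //; lra.
rewrite {2}/atom_metric (negbTE nluv) mulr1.
apply: le_trans (path_length_atom_metric _ _ _ _) _ => //.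
rewrite addrC lerD // ler_pM2l // ler_nat.
exact: leq_trans (leq_pred _) (size_cps_le _ _).
Qed.

(** At step [j = floor (sqrt n) + 1] the greedy bound reads
    [n - (j - sqrt n)^2 + j > n], more than the number of vertices. *)
Lemma few_breaks : (0 < #|V|)%N -> exists2 Ls, from_system Ls &
  forall u v, (breaks Ls (P u v))%:R <= 2 * Num.sqrt (#|V|%:R : R).
Proof.
move=> V0; set s := Num.sqrt _.
have ss : s ^+ 2 = #|V|%:R by rewrite sqr_sqrtr.
have s1 : 1 <= s by rewrite -(sqrtr1 R) ler_sqrt // ler1n.
pose j := (Num.trunc s).+1.
have sj : s < j%:R by exact: Num.Theory.truncnS_gt.
have js : j%:R <= s + 1 by rewrite -natr1 lerD2r Num.Theory.truncn_le // ltW // (lt_le_trans _ s1).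
case: (greedy_cover (2 * s) j) => // -[Ls [_ _]].
have : #|covered Ls|%:R <= s ^+ 2 by rewrite ss ler_nat max_card.
move: (j%:R : R) (#|covered Ls|%:R : R) sj js => J c sJ Js c1 c2.
nra.
Qed.

End Metric.

End ConsistentPathSystem.

Theorem theorem3p1 (R : realType) (V : finType) (e : rel V) (n : nat)
  (P : V -> V -> seq V) :
  simple_graph e -> connected_graph e -> #|V| = n ->
  consistent_path_system e P ->
  (Delta R P <= (2 * Num.sqrt (n%:R : R))%:E)%E.
Proof.
move=> _ [V0 _] <- cpsP; set b := 2 * _.
have [Ls sysLs brk] := few_breaks cpsP R V0.
have b1 : 1 <= b.
  have : 1 <= Num.sqrt (#|V|%:R : R) by rewrite -[leLHS]sqrtr1 ler_sqrt // ler1n.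
  by rewrite /b; lra.
apply/lee_addgt0Pr => d d0.
(* [eps * n] has to be at most 1 for the metric, and at most the slack [d]. *)
pose eps := Num.min 1 d / #|V|%:R.
have Vpos : 0 < #|V|%:R :> R by rewrite ltr0n.
have epsV : eps * #|V|%:R = Num.min 1 d by rewrite divfK // gt_eqF.
have eps0 : 0 < eps by rewrite divr_gt0 // lt_min ltr01.
have eps1 : eps * #|V|%:R <= 1 by rewrite epsV ge_min lexx.
have epsd : eps * #|V|%:R <= d by rewrite epsV ge_min lexx orbT.
apply: (@le_trans _ _ (b + eps * #|V|%:R)%:E); last by rewrite -EFinD lee_fin lerD2l.
apply: ereal_inf_lbound; exists (b + eps * #|V|%:R) => //; split.
  by rewrite ler_wpDr // ltW // mulr_gt0.
exact: (alpha_metric_of_breaks cpsP sysLs).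
Qed.
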